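(* Let $n \geq 1$ and let $q \in \mathbb{C}$ be a primitive $n$th root of unity. (i) If $n$ is odd, then $$\sum_{k=0}^{n-1} (q)_k(-1)^k = \frac{-1}{n^2} \sum_{k=-n}^{n-1} \sum_{j=-k}^k \mathrm{sgn}(k) \left(\frac{k(3k+1)}{2} - j^2\right)(-1)^{k+j}q^{k(3k+1)/2 - j^2},$$ and if $n$ is even, then $$\sum_{k=0}^{n-1} (q)_k(-1)^k = \frac{1}{4} \sum_{k=-n}^{n-1} \sum_{j=-k}^k \mathrm{sgn}(k)(-1)^{k+j}q^{k(3k+1)/2 - j^2}.$$ (ii) If $n$ is odd, then $$\sum_{k=0}^{n-1} (q^2;q^2)_kq^{k+1} = \frac{-1}{n^2} \sum_{k=-n}^{n-1} \sum_{j=-k}^k \mathrm{sgn}(k) \left(\frac{k(3k+1)}{2} - j^2\right)(-1)^{k+j}q^{-k(3k+1)/2 + j^2},$$ and if $n$ is even, then $$\sum_{k=0}^{n-1} (q^2;q^2)_kq^{k+1} = \frac{1}{4} \sum_{k=-n}^{n-1} \sum_{j=-k}^k \mathrm{sgn}(k)(-1)^{k+j}q^{-k(3k+1)/2 + j^2}.$$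
   Context: For a non-negative integer $k$, $(a;q)_k = \prod_{i=0}^{k-1}(1-aq^i)$, and $(a)_k$ denotes $(a;q)_k$; thus $(q)_k=\prod_{i=1}^k(1-q^i)$ and $(q^2;q^2)_k=\prod_{i=1}^k(1-q^{2i})$. The sign function is $\mathrm{sgn}(k)=1$ if $k \geq 0$ and $\mathrm{sgn}(k)=-1$ if $k<0$. Sums with reversed limits follow the convention that for any $f$, $\sum_{j=a}^b f(j) = - \sum_{j=b+1}^{a-1} f(j)$ whenever $a > b$; in particular, for $k<0$, $\sum_{j=-k}^{k} f(j) = -\sum_{j=k+1}^{-k-1} f(j)$. *)

(* Defs.v *)
From HB Require Import structures.
From mathcomp Require Import all_boot all_order all_algebra.
From mathcomp Require Import reals.
From mathcomp Require Import complex.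
From mathcomp Require Import zify.
Set Implicit Arguments.
Unset Strict Implicit.
Unset Printing Implicit Defensive.
Import Order.TTheory GRing.Theory Num.Theory.
Local Open Scope ring_scope.

Definition qpoch (C : nzRingType) (a q : C) (k : nat) : C :=
  \prod_(i < k) (1 - a * q ^+ i).

(* Unlike the library's sgz, this takes the value 1 at 0. *)
Definition sgn (k : int) : int := if 0 <= k then 1 else -1.

(* \sum_{j=a}^{b} f(j) over the integers, both bounds included; a reversed
   sum (a > b) is minus the sum of f over b+1, ..., a-1. *)
Definition isum (V : zmodType) (a b : int) (f : int -> V) : V :=
  if a <= b then \sum_(i < (absz (b - a)%R).+1) f (a + i%:Z)
  else - \sum_(i < (absz (a - b)%R).-1) f (b + 1 + i%:Z).

Lemma isum_rev (V : zmodType) (a b : int) (f : int -> V) :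
  b < a -> isum a b f = - isum (b + 1) (a - 1) f.
Proof.
move=> ltba; rewrite /isum leNgt ltba /=; case: ifP => h.
  by have -> : (absz (a - b)%R).-1 = (absz (a - 1 - (b + 1))%R).+1 by lia.
have -> : (absz (a - b)%R).-1 = 0%N by lia.
have -> : (absz (b + 1 - (a - 1))%R).-1 = 0%N by lia.
by rewrite !big_ord0 !oppr0.
Qed.

(* k(3k+1) is always even, so the integer division is exact. *)
Definition hecke_exp (k j : int) : int := (k * (3 * k + 1) %/ 2)%Z - j ^+ 2.

(* Main.v *)
Require Import Defs.
From mathcomp Require Import all_boot all_order all_algebra.
From mathcomp Require Import reals complex.
From mathcomp Require Import ring zify.
Set Implicit Arguments.
Unset Strict Implicit.
Unset Printing Implicit Defensive.
Import Order.TTheory GRing.Theory Num.Theory.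
Local Open Scope ring_scope.
Local Open Scope complex_scope.

(** Write (q)_k for (q;q)_k and A_r for the sum of (-1)^j q^(-j^2) over
    |j| <= r. The source of the double sums is an identity valid for every q
    that is not a root of unity ([hecke_identity]):

      sum_(r <= N) q^(2r^2+r) (1 - q^(2r+1)) A_r / ((q)_(N-r) (q)_(N+r+1))
        = 1/(-q)_N * sum_(m <= N) q^(m(m+1)/2) / (q)_(N-m).

    It is obtained by a Bailey chain. Summation by parts and the evaluation of
    an alternating sum of q-binomial coefficients give a Bailey pair whose left
    member contains A_r ([bailey_pair_theta]); the limiting case of Bailey's
    lemma in [bailey_step], which rests on the q-Chu-Vandermonde sum, is then
    applied twice.

    For N = n-1 the identity can be cleared of everything singular at the n-th
    roots of unity ([hecke_identity_product]):

      (-q)_(n-1) * sum_(r < n) c_r(q) rho_r(q)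
        = (q)_(n-1) * (1 - q^n) * sum_(m < n) prod_(1 <= i <= m) (q^i - q^n),

    where c_r collects the terms k = r and k = -r-1 of the double sum and
    rho_r is regular with value 1 at a primitive n-th root of unity z. At q = z
    the last sum is the sum of (z)_m (-1)^m, and its factor 1 - q^n vanishes.

    - If n is even, (-q)_(n-1) contains 1 + q^(n/2), which also divides
      1 - q^n; after cancelling it one compares values at z
      ([double_sum_even]).
    - If n is odd, one compares the derivatives q d/dq at z
      ([double_sum_odd]). Each power q^h in c_r contributes h z^h, which is the
      weight in the theorem. The derivatives of the rho_r contribute the sum of
      c_r(z) rho_r'(z), which is zero because c_r(z) changes sign under
      r -> n-1-r ([hecke_block_reflect]) while rho_r'(z) is invariant
      ([log_derivative_reflect]).

    To have q generic and still specialise at z, q is the indeterminate of a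
    field of rational functions, and values and derivatives at z are those of
    fractions whose denominator does not vanish at z.

    Part (ii) at z is part (i) at 1/z: the sums of (z)_k (xz)_k z^(k+1) and of
    (1/z;1/z)_k x^k satisfy the same first-order z-difference equation in x,
    which has only one solution ([sum_qpoch_inversion]); take x = -1. *)

(** * Pochhammer symbols and triangular sums *)

Section Pochhammer.
Variable R : comNzRingType.
Implicit Types (a q : R) (k m : nat).

Lemma qpoch0 a q : qpoch a q 0 = 1.
Proof. by rewrite /qpoch big_ord0. Qed.

Lemma qpochS a q k : qpoch a q k.+1 = qpoch a q k * (1 - a * q ^+ k).
Proof. by rewrite /qpoch big_ord_recr. Qed.

Lemma qpoch_qS q k : qpoch q q k.+1 = qpoch q q k * (1 - q ^+ k.+1).
Proof. by rewrite qpochS -exprS. Qed.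

Lemma qpochD a q m k :
  qpoch a q (m + k) = qpoch a q m * qpoch (a * q ^+ m) q k.
Proof.
elim: k => [|k IHk]; first by rewrite addn0 qpoch0 mulr1.
by rewrite addnS !qpochS IHk exprD !mulrA.
Qed.

Lemma qpochSl a q k : qpoch a q k.+1 = (1 - a) * qpoch (a * q) q k.
Proof.
by rewrite -add1n qpochD qpochS qpoch0 mul1r expr0 expr1 mulr1.
Qed.

Lemma qpoch0l q k : qpoch 0 q k = 1.
Proof. by rewrite /qpoch big1 // => i _; rewrite mul0r subr0. Qed.
End Pochhammer.

Lemma bin2S m : 'C(m.+1, 2) = ('C(m, 2) + m)%N.
Proof. by rewrite binS bin1. Qed.

Lemma mulS_bin2 m : (m.+1 * m = 'C(m.+1, 2) + 'C(m.+1, 2))%N.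
Proof. by elim: m => [|m IHm] //; rewrite bin2S; lia. Qed.

Lemma triangular_exchange (V : nmodType) (N : nat) (f : nat -> nat -> V) :
  \sum_(m < N.+1) \sum_(r < m.+1) f m r
  = \sum_(r < N.+1) \sum_(i < (N - r).+1) f (r + i)%N r.
Proof.
elim: N => [|N IHN]; first by rewrite !big_ord1.
rewrite big_ord_recr /= IHN [in RHS]big_ord_recr /= subnn big_ord1 addn0.
rewrite [X in _ + X]big_ord_recr /= addrA; congr (_ + _).
rewrite -big_split /=; apply: eq_bigr => r _.
have le_rN : (r <= N)%N by rewrite -ltnS.
by rewrite subSn // [in RHS]big_ord_recr /= -subSn // subnKC // ltnW.
Qed.

(** * Bailey pairs for generic q *)

Section GenericField.
Variables (F : fieldType) (q : F).
Hypothesis q_neq0 : q != 0.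
Hypothesis q_generic : forall k : nat, q ^+ k.+1 != 1.

Lemma subr_qX_neq0 k : 1 - q ^+ k.+1 != 0.
Proof. by rewrite subr_eq0 eq_sym q_generic. Qed.

Lemma qpoch_q_neq0 k : qpoch q q k != 0.
Proof.
elim: k => [|k IHk]; first by rewrite qpoch0 oner_eq0.
by rewrite qpoch_qS mulf_neq0 ?subr_qX_neq0.
Qed.

Lemma qpoch_Nq_neq0 k : qpoch (- q) q k != 0.
Proof.
elim: k => [|k IHk]; first by rewrite qpoch0 oner_eq0.
rewrite qpochS mulf_neq0 // mulNr opprK -exprS.
apply: contraNneq (subr_qX_neq0 (k + k).+1) => q1.
have -> : (k + k).+2 = (k.+1 + k.+1)%N by rewrite addnS.
rewrite exprD.
have -> : q ^+ k.+1 = -1 by apply/eqP; rewrite -subr_eq0 opprK addrC q1.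
by rewrite mulN1r opprK subrr.
Qed.

(** The q-Chu-Vandermonde sum with numerator parameters q^(-M), b, denominator
    parameter c = bd and argument d q^M, written so that c and d may vanish.
    Pascal's rule reduces M+1 to M with d replaced by dq. *)
Lemma q_chu_vandermonde (M : nat) (b d : F) :
  \sum_(i < M.+1) (-1) ^+ i * q ^+ 'C(i, 2) * d ^+ i * qpoch b q i
      * qpoch (b * d * q ^+ i) q (M - i) / (qpoch q q i * qpoch q q (M - i))
  = qpoch d q M / qpoch q q M.
Proof.
elim: M d => [|M IHM] d.
  by rewrite big_ord1 /= !qpoch0 !expr0 !mulr1.
have nzM := subr_qX_neq0 M.
apply: (mulfI nzM).
rewrite qpoch_qS (qpochSl d).
transitivity ((1 - d) * (qpoch (d * q) q M / qpoch q q M)); last first.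
  by field; rewrite nzM qpoch_q_neq0.
rewrite -IHM !mulr_sumr.
pose u i := (-1) ^+ i * q ^+ 'C(i, 2) * d ^+ i * qpoch b q i
      * qpoch (b * d * q ^+ i) q (M.+1 - i).
(* Pascal's rule 1 - q^(M+1) = q^i (1 - q^(M+1-i)) + (1 - q^i). *)
transitivity (\sum_(i < M.+1) u i * q ^+ i / (qpoch q q i * qpoch q q (M - i))
   + \sum_(i < M.+1) u i.+1 / (qpoch q q i * qpoch q q (M - i))).
  transitivity (\sum_(i < M.+2)
       (u i * (q ^+ i * (1 - q ^+ (M.+1 - i)))
          / (qpoch q q i * qpoch q q (M.+1 - i))
      + u i * (1 - q ^+ i) / (qpoch q q i * qpoch q q (M.+1 - i)))).
    apply: eq_bigr => i _; rewrite -/(u i).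
    have -> : q ^+ M.+1 = q ^+ i * q ^+ (M.+1 - i).
      by rewrite -exprD subnKC // -ltnS.
    by rewrite -mulrDl -mulrDr mulrA [_ * u i]mulrC; congr (_ * _ / _); ring.
  rewrite big_split /=; congr (_ + _).
    rewrite big_ord_recr /= subnn expr0 subrr !(mulr0, mul0r) addr0.
    apply: eq_bigr => i _.
    rewrite subSn -1?ltnS // qpoch_qS.
    by field; rewrite subr_qX_neq0 !qpoch_q_neq0.
  rewrite big_ord_recl /= expr0 subrr !(mulr0, mul0r) add0r.
  apply: eq_bigr => i _.
  rewrite /bump /= add1n subSS qpoch_qS.
  by field; rewrite subr_qX_neq0 !qpoch_q_neq0.
rewrite -big_split /=; apply: eq_bigr => i _.
rewrite -mulrDl mulrA; congr (_ / _).
rewrite /u subSS bin2S subSn -1?ltnS // qpochSl (qpochS b) !exprD !exprS exprMn.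
have -> : b * d * (q * q ^+ i) = b * (d * q) * q ^+ i by ring.
have -> : b * d * q ^+ i * q = b * (d * q) * q ^+ i by ring.
by ring.
Qed.

(** Bailey pairs relative to a = q. The denominator (q)_(n+r+1) stands for
    (q^2)_(n+r) of the usual definition: the constant 1 - q is absorbed in
    [alpha]. *)
Definition bailey_pair (alpha beta : nat -> F) :=
  forall n, beta n = \sum_(r < n.+1) alpha r
                       / (qpoch q q (n - r) * qpoch q q (n + r).+1).

(** The inner sum that appears when a Bailey pair is inserted in
    [bailey_step] and the order of summation is exchanged: it is
    [q_chu_vandermonde] with M = N - r and b = d = -q^(r+1). *)
Lemma bailey_kernel (N r : nat) : (r <= N)%N ->
  \sum_(i < (N - r).+1) q ^+ 'C((r + i).+1, 2) * qpoch (- q) q (r + i)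
     / qpoch q q (N - (r + i))
     / (qpoch q q (r + i - r) * qpoch q q (r + i + r).+1)
  = qpoch (- q) q N * q ^+ 'C(r.+1, 2)
     / (qpoch q q (N - r) * qpoch q q (N + r).+1).
Proof.
move=> le_rN.
have [M defN] : exists M, N = (r + M)%N by exists (N - r)%N; rewrite subnKC.
rewrite defN addKn.
pose x := - q ^+ r.+1.
have Hx k : qpoch (- q) q (r + k) = qpoch (- q) q r * qpoch x q k.
  by rewrite qpochD mulNr -exprS.
have Hxx k : qpoch q q (r + k + r).+1
             = qpoch q q (r + r).+1 * qpoch (x * x) q k.
  rewrite addnAC -addSn qpochD -exprS /x mulrNN -exprD.
  by rewrite !addSn addnS.
transitivity (q ^+ 'C(r.+1, 2) * qpoch (- q) q r / qpoch q q (r + M + r).+1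
   * (qpoch x q M / qpoch q q M)); last first.
  by rewrite Hx; field; rewrite !qpoch_q_neq0.
rewrite -(q_chu_vandermonde M x x) mulr_sumr; apply: eq_bigr => i _.
have le_iM : (i <= M)%N by rewrite -ltnS.
rewrite subnDl addKn Hx.
have -> : qpoch q q (r + M + r).+1
          = qpoch q q (r + i + r).+1 * qpoch (x * x * q ^+ i) q (M - i).
  by rewrite !Hxx -{1}(subnKC le_iM) qpochD mulrA.
have nz : qpoch (x * x * q ^+ i) q (M - i) != 0.
  have := qpoch_q_neq0 (r + M + r).+1.
  by rewrite Hxx -{1}(subnKC le_iM) qpochD !mulf_eq0 !negb_or => /and3P[].
have -> : 'C((r + i).+1, 2) = ('C(r.+1, 2) + (r.+1 * i + 'C(i, 2)))%N.
  elim: (nat_of_ord i) => [|j IHj]; first by rewrite muln0 !addn0.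
  by rewrite addnS bin2S IHj (bin2S j) mulnS; lia.
rewrite exprD [q ^+ (_ * _ + _)]exprD exprM.
have -> : q ^+ r.+1 ^+ i = (-1) ^+ i * x ^+ i.
  by rewrite -exprMn mulN1r opprK.
by field; rewrite nz !qpoch_q_neq0.
Qed.

(** Bailey's lemma relative to a = q, with one parameter equal to -q and the
    other one tending to infinity. For this choice the factor that multiplies
    [alpha] is a pure power of q. *)
Lemma bailey_step (alpha beta : nat -> F) :
  bailey_pair alpha beta ->
  bailey_pair (fun r => q ^+ 'C(r.+1, 2) * alpha r)
    (fun n => (qpoch (- q) q n)^-1 * \sum_(m < n.+1)
       q ^+ 'C(m.+1, 2) * qpoch (- q) q m / qpoch q q (n - m) * beta m).
Proof.
move=> pair_ab N; apply: (mulfI (qpoch_Nq_neq0 N)).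
rewrite /= mulVKf ?qpoch_Nq_neq0 // mulr_sumr.
under eq_bigr => m _ do rewrite pair_ab mulr_sumr.
pose f m r := q ^+ 'C(m.+1, 2) * qpoch (- q) q m / qpoch q q (N - m)
   * (alpha r / (qpoch q q (m - r) * qpoch q q (m + r).+1)).
rewrite (triangular_exchange N f) /f; apply: eq_bigr => r _.
transitivity (alpha r * (qpoch (- q) q N * q ^+ 'C(r.+1, 2)
     / (qpoch q q (N - r) * qpoch q q (N + r).+1))); last by ring.
rewrite -bailey_kernel -1?ltnS // mulr_sumr; apply: eq_bigr => i _.
by ring.
Qed.

(** The terms j = s and j = -s of the sum of (-1)^j q^(-j^2), together; they
    are a single term when s = 0. *)
Definition theta_term (s : nat) : F := ((-1) ^+ s / q ^+ (s * s)) *+ (0 < s).+1.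

Definition partial_theta (r : nat) : F := \sum_(s < r.+1) theta_term s.

(** Summation by parts: with u_r = q^(r^2) / ((q)_(n-r) (q)_(n+r)), the
    factor of [partial_theta q r] on the left is u_r - u_(r+1), and the
    differences of the partial theta sums cancel the powers q^(r^2). *)
Lemma abel_partial_theta n :
  \sum_(r < n.+1) q ^+ (r * r) * (1 - q ^+ (2 * r).+1) * partial_theta r
     / (qpoch q q (n - r) * qpoch q q (n + r).+1)
  = \sum_(s < n.+1) (-1) ^+ s *+ (0 < s).+1
      / (qpoch q q (n - s) * qpoch q q (n + s)).
Proof.
(* v t is u_(t+1), in a form that makes sense, and vanishes, at t = n. *)
pose v t := q ^+ (t.+1 * t.+1) * (1 - q ^+ (n - t))
   / (qpoch q q (n - t) * qpoch q q (n + t).+1).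
suff step t : (t <= n)%N ->
  \sum_(r < t.+1) q ^+ (r * r) * (1 - q ^+ (2 * r).+1) * partial_theta r
     / (qpoch q q (n - r) * qpoch q q (n + r).+1)
  = \sum_(s < t.+1) (-1) ^+ s *+ (0 < s).+1
      / (qpoch q q (n - s) * qpoch q q (n + s)) - partial_theta t * v t.
  by rewrite step // /v subnn expr0 subrr !(mulr0, mul0r) subr0.
elim: t => [|t IHt] le_tn.
  rewrite !big_ord1 /partial_theta big_ord1 /theta_term /v /=.
  have := subr_qX_neq0 n; have nz := qpoch_q_neq0 n.
  rewrite !subn0 !addn0 !qpoch_qS !exprS !mulr1n !expr0 => nz1.
  by field; rewrite nz nz1 oner_eq0.
rewrite big_ord_recr /= IHt 1?ltnW // [in RHS]big_ord_recr /=.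
have -> : partial_theta t.+1 = partial_theta t + theta_term t.+1.
  by rewrite /partial_theta big_ord_recr.
set A := partial_theta t; set S := \sum_(s < t.+1) _.
rewrite /v /theta_term /=.
have [m defn] : exists m, n = (m + t.+1)%N by exists (n - t.+1)%N; rewrite subnK.
have -> : (n - t = m.+1)%N by lia.
have -> : (n - t.+1 = m)%N by lia.
have -> : (n + t).+1 = (n + t.+1)%N by lia.
have nz1 := subr_qX_neq0 (n + t.+1).
have nz2 := subr_qX_neq0 m.
rewrite !qpoch_qS.
have E1 : q ^+ (n + t.+1).+1 = q * q ^+ m * (q ^+ t.+1 * q ^+ t.+1).
  by rewrite -exprS -!exprD; congr (_ ^+ _); lia.
have E2 : q ^+ (t.+2 * t.+2)
    = q * (q ^+ t.+1 * q ^+ t.+1) * q ^+ (t.+1 * t.+1).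
  by rewrite -!exprD -exprS -exprD; congr (_ ^+ _); lia.
have E3 : q ^+ (2 * t.+1).+1 = q * (q ^+ t.+1 * q ^+ t.+1).
  by rewrite exprS -exprD; congr (_ * _ ^+ _); lia.
have nz3 : q ^+ (t.+1 * t.+1) != 0 by rewrite expf_neq0.
have nz4 := qpoch_q_neq0 m; have nz5 := qpoch_q_neq0 (n + t.+1).
move: nz1 nz2; rewrite E1 E2 E3 exprS.
set X := q ^+ m; set Y := q ^+ t.+1; move: nz3.
set Z := q ^+ (t.+1 * t.+1) => nz3 nz1 nz2.
by field; rewrite nz1 nz2 nz3 nz4 nz5.
Qed.

(** Gauss's evaluation of the alternating sum of the q-binomial coefficients
    of order 2n, folded around its centre. Both sides satisfy
    (1 - q^(2n+2)) b_(n+1) = - b_n; for the sum this holds because the terms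
    of (1 - q^(2n+2)) b_(n+1) + b_n telescope. *)
Lemma sum_alternating_gauss n :
  \sum_(s < n.+1) (-1) ^+ s *+ (0 < s).+1
      / (qpoch q q (n - s) * qpoch q q (n + s))
  = (-1) ^+ n / (qpoch q q n * qpoch (- q) q n).
Proof.
elim: n => [|n IHn].
  by rewrite big_ord1 /= !qpoch0 mulr1n expr0 !mulr1.
have nzP : (1 - q ^+ n.+1) * (1 + q ^+ n.+1) != 0.
  rewrite mulf_neq0 ?subr_qX_neq0 //.
  have := qpoch_Nq_neq0 n.+1; rewrite qpochS mulf_eq0 negb_or => /andP[_].
  by rewrite mulNr opprK -exprS.
pose k m s : F := (-1) ^+ s *+ (0 < s).+1
      / (qpoch q q (m - s) * qpoch q q (m + s)).
have tele t : (t <= n)%N ->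
    \sum_(s < t.+1) ((1 - q ^+ n.+1) * (1 + q ^+ n.+1) * k n.+1 s + k n s)
    = (-1) ^+ t *+ 2 / (qpoch q q (n - t) * qpoch q q (n + t).+1).
  elim: t => [|t IHt] le_tn.
    rewrite big_ord1 /k /= !subn0 !addn0 !qpoch_qS !mulr1n !expr0.
    have nz := subr_qX_neq0 n; have nz2 := qpoch_q_neq0 n.
    by field; rewrite nz nz2.
  rewrite big_ord_recr /= IHt 1?ltnW // /k /=.
  have [m defn] : exists m, n = (m + t.+1)%N.
    by exists (n - t.+1)%N; rewrite subnK.
  have -> : (n.+1 - t.+1 = m.+1)%N by lia.
  have -> : (n - t.+1 = m)%N by lia.
  have -> : (n - t = m.+1)%N by lia.
  have -> : (n.+1 + t.+1 = (n + t.+1).+1)%N by lia.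
  have -> : (n + t).+1 = (n + t.+1)%N by lia.
  have nz1 := subr_qX_neq0 m; have nz2 := subr_qX_neq0 (n + t.+1).
  have nz4 := qpoch_q_neq0 m; have nz5 := qpoch_q_neq0 (n + t.+1).
  rewrite !qpoch_qS.
  have E1 : q ^+ (n + t.+1).+1 = q ^+ n.+1 * q ^+ t.+1.
    by rewrite -exprD addSn.
  have E2 : q ^+ n.+1 = q ^+ m.+1 * q ^+ t.+1.
    by rewrite -exprD; congr (_ ^+ _); lia.
  move: nz1 nz2; rewrite E1 E2 [(-1) ^+ t.+1]exprS.
  set X := q ^+ m.+1; set Y := q ^+ t.+1 => nz1 nz2.
  by field; rewrite nz1 nz2 nz4 nz5.
have stepE : (1 - q ^+ n.+1) * (1 + q ^+ n.+1) * (\sum_(s < n.+2) k n.+1 s)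
   = - \sum_(s < n.+1) k n s.
  apply/eqP; rewrite -subr_eq0 opprK big_ord_recr /= mulrDr addrAC mulr_sumr.
  rewrite -big_split /= tele // /k /= !subnn qpoch0.
  have -> : (n.+1 + n.+1 = (n + n).+2)%N by lia.
  have nz2 := subr_qX_neq0 (n + n).+1; have nz5 := qpoch_q_neq0 (n + n).+1.
  rewrite (qpoch_qS q (n + n).+1).
  have E2 : q ^+ (n + n).+2 = q ^+ n.+1 * q ^+ n.+1.
    by rewrite -exprD; congr (_ ^+ _); lia.
  move: nz2; rewrite E2 [(-1) ^+ n.+1]exprS.
  set X := q ^+ n.+1 => nz2; apply/eqP.
  by field; rewrite nz2 nz5.
apply: (mulfI nzP); rewrite -/(k n.+1) stepE /k IHn.
have nz4 := qpoch_q_neq0 n; have nz5 := qpoch_Nq_neq0 n.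
have -> : qpoch (- q) q n.+1 = qpoch (- q) q n * (1 + q ^+ n.+1).
  by rewrite qpochS mulNr opprK -exprS.
rewrite qpoch_qS [(-1) ^+ n.+1]exprS.
move: nzP; set X := q ^+ n.+1 => nzP.
move: nzP; rewrite mulf_eq0 negb_or => /andP[nz1 nz2].
by field; rewrite nz1 nz2 nz4 nz5.
Qed.

Lemma bailey_pair_theta :
  bailey_pair (fun r => q ^+ (r * r) * (1 - q ^+ (2 * r).+1) * partial_theta r)
    (fun n => (-1) ^+ n / (qpoch q q n * qpoch (- q) q n)).
Proof. by move=> n; rewrite abel_partial_theta sum_alternating_gauss. Qed.

(** The sum over m produced by [bailey_step] is
    sum_m (-1)^m q^(m(m+1)/2) / ((q)_m (q)_(n-m)) = 1, which is
    [q_chu_vandermonde] with b = 0 and d = q. *)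
Lemma bailey_pair_theta_step :
  bailey_pair
    (fun r => q ^+ 'C(r.+1, 2) *
        (q ^+ (r * r) * (1 - q ^+ (2 * r).+1) * partial_theta r))
    (fun n => (qpoch (- q) q n)^-1).
Proof.
move=> n; rewrite -(bailey_step bailey_pair_theta).
rewrite -[LHS]mulr1; congr (_ * _).
have := q_chu_vandermonde n 0 q.
rewrite divff ?qpoch_q_neq0 // => sum1; rewrite -[LHS]sum1.
apply: eq_bigr => m _; rewrite mul0r mul0r !qpoch0l bin2S exprD.
by field; rewrite !qpoch_q_neq0 qpoch_Nq_neq0.
Qed.

(** [bailey_step] applied to [bailey_pair_theta_step]; the two applications
    together multiply [alpha] by q^(r(r+1)). *)
Lemma hecke_identity N :
  \sum_(r < N.+1) q ^+ (r.+1 * r) * q ^+ (r * r) * (1 - q ^+ (2 * r).+1)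
      * partial_theta r / (qpoch q q (N - r) * qpoch q q (N + r).+1)
  = (qpoch (- q) q N)^-1
    * \sum_(m < N.+1) q ^+ 'C(m.+1, 2) / qpoch q q (N - m).
Proof.
transitivity ((qpoch (- q) q N)^-1 * \sum_(m < N.+1)
  q ^+ 'C(m.+1, 2) * qpoch (- q) q m / qpoch q q (N - m)
   * (qpoch (- q) q m)^-1).
  rewrite (bailey_step bailey_pair_theta_step); apply: eq_bigr => r _.
  by rewrite mulS_bin2 exprD !mulrA.
congr (_ * _); apply: eq_bigr => m _.
by field; rewrite !qpoch_q_neq0 qpoch_Nq_neq0.
Qed.
End GenericField.

(** * The double sum, block by block *)

Lemma hecke_exp_nat (r s : nat) :
  hecke_exp r s = ('C(r.+1, 2) + r * r)%:Z - (s * s)%:Z.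
Proof.
rewrite /hecke_exp expr2 -PoszM; congr (_ - _).
have -> : r%:Z * (3 * r%:Z + 1) = ('C(r.+1, 2) + r * r)%:Z * 2.
  by have := mulS_bin2 r; lia.
by rewrite mulzK.
Qed.

Lemma hecke_exp_neg (r s : nat) :
  hecke_exp (- r.+1%:Z) s = ('C(r.+1, 2) + r * r + (2 * r).+1)%:Z - (s * s)%:Z.
Proof.
rewrite /hecke_exp expr2 -PoszM; congr (_ - _).
have -> : - r.+1%:Z * (3 * - r.+1%:Z + 1)
          = ('C(r.+1, 2) + r * r + (2 * r).+1)%:Z * 2.
  by have := mulS_bin2 r; lia.
by rewrite mulzK.
Qed.

(** The contribution of k = r and k = -r-1 to the double sum of a function
    [phi] of the exponent, with the terms j = s and j = -s put together. *)
Definition hecke_block (C : pzRingType) (phi : int -> C) (r : nat) : C :=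
  \sum_(s < r.+1) ((-1) ^+ (r + s) *
    (phi (hecke_exp r s) - phi (hecke_exp (- r.+1%:Z) s))) *+ (0 < s).+1.

Section HeckeBlockField.
Variables (F : fieldType) (q : F).
Hypothesis q_neq0 : q != 0.

(** The exponents of k = r and k = -r-1 differ by 2r+1. *)
Lemma hecke_block_theta r :
  hecke_block (fun h => q ^ h) r
  = (-1) ^+ r * q ^+ ('C(r.+1, 2) + r * r) * (1 - q ^+ (2 * r).+1)
    * partial_theta q r.
Proof.
rewrite /partial_theta mulr_sumr; apply: eq_bigr => s _.
rewrite /theta_term mulrnAr; congr (_ *+ _).
rewrite hecke_exp_nat hecke_exp_neg !expfzDr // !exprnN -!exprnP.
by rewrite !exprD; ring.
Qed.

Hypothesis q_generic : forall k : nat, q ^+ k.+1 != 1.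

Lemma kernel_product N r : (r <= N)%N ->
  (-1) ^+ r * q ^+ 'C(r.+1, 2) / (qpoch q q (N - r) * qpoch q q (N + r).+1)
  = \prod_(i < r) ((q ^+ N.+1 - q ^+ i.+1) / (1 - q ^+ (N.+1 + i.+1)))
    / (qpoch q q N * qpoch q q N.+1).
Proof.
elim: r => [|r IHr] le_rN.
  by rewrite big_ord0 subn0 addn0 expr0 mul1r.
rewrite big_ord_recr /= [RHS]mulrAC -IHr 1?ltnW //.
have [m defN] : exists m, N = (m + r.+1)%N by exists (N - r.+1)%N; rewrite subnK.
have -> : (N - r = m.+1)%N by lia.
have -> : (N - r.+1 = m)%N by lia.
have -> : (N + r).+1 = (N + r.+1)%N by lia.
have -> : (N.+1 + r.+1 = (N + r.+1).+1)%N by lia.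
rewrite !qpoch_qS bin2S exprD exprS.
have -> : q ^+ N.+1 = q ^+ m.+1 * q ^+ r.+1.
  by rewrite -exprD; congr (_ ^+ _); lia.
have := subr_qX_neq0 q_generic m; have := subr_qX_neq0 q_generic (N + r.+1).
have := qpoch_q_neq0 q_generic m; have := qpoch_q_neq0 q_generic (N + r.+1).
set X := q ^+ m.+1; set Y := q ^+ r.+1; set Z := q ^+ (N + r.+1).+1.
by move=> nz1 nz2 nz3 nz4; field; rewrite nz1 nz2 nz3 nz4.
Qed.

Lemma qpoch_quotient_product N m : (m <= N)%N ->
  q ^+ 'C(m.+1, 2) / qpoch q q (N - m)
  = \prod_(i < m) (q ^+ i.+1 - q ^+ N.+1) / qpoch q q N.
Proof.
elim: m => [|m IHm] le_mN.
  by rewrite big_ord0 subn0 expr0.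
rewrite big_ord_recr /= [RHS]mulrAC -IHm 1?ltnW //.
have [k defN] : exists k, N = (k + m.+1)%N by exists (N - m.+1)%N; rewrite subnK.
have -> : (N - m = k.+1)%N by lia.
have -> : (N - m.+1 = k)%N by lia.
rewrite qpoch_qS bin2S exprD.
have -> : q ^+ N.+1 = q ^+ k.+1 * q ^+ m.+1.
  by rewrite -exprD; congr (_ ^+ _); lia.
have := subr_qX_neq0 q_generic k; have := qpoch_q_neq0 q_generic k.
set X := q ^+ k.+1; set Y := q ^+ m.+1 => nz1 nz2.
by field; rewrite nz1 nz2.
Qed.

(** [hecke_identity] multiplied by (q)_N (q)_(N+1) (-q)_N. With n = N+1, the
    only factors left that vanish at a primitive n-th root of unity are
    1 - q^n and, for even n, 1 + q^(n/2) inside (-q)_N. *)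
Lemma hecke_identity_product N :
  qpoch (- q) q N * (\sum_(r < N.+1) hecke_block (fun h => q ^ h) r
     * \prod_(i < r) ((q ^+ N.+1 - q ^+ i.+1) / (1 - q ^+ (N.+1 + i.+1))))
  = qpoch q q N * (1 - q ^+ N.+1)
    * \sum_(m < N.+1) \prod_(i < m) (q ^+ i.+1 - q ^+ N.+1).
Proof.
have nz1 := qpoch_q_neq0 q_generic N; have nz2 := subr_qX_neq0 q_generic N.
have nz3 := qpoch_Nq_neq0 q_generic N.
transitivity (qpoch (- q) q N * (qpoch q q N * qpoch q q N.+1) *
  ((qpoch (- q) q N)^-1
    * \sum_(m < N.+1) q ^+ 'C(m.+1, 2) / qpoch q q (N - m))).
  rewrite -hecke_identity // -mulrA; congr (_ * _).
  rewrite mulr_sumr; apply: eq_bigr => r _.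
  have le_rN : (r <= N)%N by rewrite -ltnS.
  transitivity (qpoch q q N * qpoch q q N.+1 * (hecke_block (fun h => q ^ h) r *
    ((-1) ^+ r * q ^+ 'C(r.+1, 2)
       / (qpoch q q (N - r) * qpoch q q (N + r).+1)))).
    by rewrite kernel_product // qpoch_qS; field; rewrite nz1 nz2.
  congr (_ * _); rewrite hecke_block_theta mulS_bin2.
  move: 'C(r.+1, 2) => B; rewrite !exprD.
  have sq1 : (-1) ^+ r * (-1) ^+ r = 1 :> F.
    by rewrite -exprMn mulN1r opprK expr1n.
  rewrite -[RHS]mul1r -[X in _ = X * _]sq1.
  by ring.
transitivity (qpoch q q N * (1 - q ^+ N.+1) * (qpoch q q N *
  \sum_(m < N.+1) q ^+ 'C(m.+1, 2) / qpoch q q (N - m))).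
  rewrite qpoch_qS; set S := \sum_(m < N.+1) _.
  by field.
congr (_ * _); rewrite mulr_sumr; apply: eq_bigr => m _.
by rewrite qpoch_quotient_product -1?ltnS // mulrC divfK.
Qed.
End HeckeBlockField.

(** * First-order expansions of rational functions at a point *)

Section Jets.
Variables (C : fieldType) (z : C).
Local Notation K := {fraction {poly C}}.
Local Notation "p %:F" := (@FracField.tofrac {poly C} p).
Implicit Types (f g : K) (a b : C).

(** [f] is regular at [z] with value [a], and [b] is the value there of the
    Euler derivative q df/dq, for which q^h is an eigenvector with eigenvalue
    h. The conditions say so for a fraction p/s representing [f], cleared of
    the divisions by s. *)
Definition jet f a b := exists p s : {poly C},
  [/\ s.[z] != 0, f * s%:F = p%:F, p.[z] = a * s.[z]
    & z * p^`().[z] = b * s.[z] + a * (z * s^`().[z])].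

Definition has_value f a := exists b, jet f a b.

Lemma jet_poly (p : {poly C}) : jet p%:F p.[z] (z * p^`().[z]).
Proof.
exists p, 1; rewrite tofrac1 hornerC derivC horner0 !mulr0 addr0 !mulr1.
by split=> //; rewrite oner_eq0.
Qed.

Lemma jetD f g a b c d : jet f a b -> jet g c d -> jet (f + g) (a + c) (b + d).
Proof.
move=> [p [s [nzs fE pE dpE]]] [p' [s' [nzs' gE pE' dpE']]].
exists (p * s' + p' * s), (s * s'); split.
- by rewrite hornerM mulf_neq0.
- by rewrite tofracD !tofracM -fE -gE; ring.
- by rewrite !(hornerD, hornerM) pE pE'; ring.
- rewrite derivD !derivM !(hornerD, hornerM) !mulrDr.
  transitivity (z * p^`().[z] * s'.[z] + p.[z] * (z * s'^`().[z])
     + (z * p'^`().[z] * s.[z] + p'.[z] * (z * s^`().[z]))); first by ring.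
  by rewrite dpE dpE' pE pE'; ring.
Qed.

Lemma jetM f g a b c d :
  jet f a b -> jet g c d -> jet (f * g) (a * c) (b * c + a * d).
Proof.
move=> [p [s [nzs fE pE dpE]]] [p' [s' [nzs' gE pE' dpE']]].
exists (p * p'), (s * s'); split.
- by rewrite hornerM mulf_neq0.
- by rewrite !tofracM -fE -gE; ring.
- by rewrite !(hornerD, hornerM) pE pE'; ring.
- rewrite !derivM !(hornerD, hornerM).
  transitivity (z * p^`().[z] * p'.[z] + p.[z] * (z * p'^`().[z]));
    first by ring.
  by rewrite dpE dpE' pE pE'; ring.
Qed.

Lemma jetV f a b : a != 0 -> jet f a b -> jet f^-1 a^-1 (- b / (a * a)).
Proof.
move=> nza [p [s [nzs fE pE dpE]]].
have nzp : p.[z] != 0 by rewrite pE mulf_neq0.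
have nzpF : p%:F != 0.
  by rewrite tofrac_eq0; apply: contraNneq nzp => ->; rewrite horner0.
exists s, p; split=> //.
- have nzf : f != 0 by apply: contraNneq nzpF => f0; rewrite -fE f0 mul0r.
  by rewrite -fE (mulKf nzf).
- by rewrite pE mulKf.
- by rewrite dpE pE; field.
Qed.

Lemma jet_unique f a b c d : jet f a b -> jet f c d -> a = c /\ b = d.
Proof.
move=> [p [s [nzs fE pE dpE]]] [p' [s' [nzs' fE' pE' dpE']]].
have cross : p * s' = p' * s.
  by apply/eqP; rewrite -tofrac_eq !tofracM -fE -fE'; apply/eqP; ring.
have ac : a = c.
  apply: (mulIf nzs); apply: (mulIf nzs').
  by rewrite -pE -hornerM cross hornerM pE'; ring.
split=> //; apply: (mulIf nzs); apply: (mulIf nzs').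
have leibniz u v : z * u^`().[z] * v.[z] + u.[z] * (z * v^`().[z])
                   = z * (u * v)^`().[z].
  by rewrite derivM hornerD !hornerM; ring.
have := leibniz p s'; rewrite cross -leibniz dpE dpE' pE pE' ac => E.
have -> : b * s.[z] * s'.[z]
  = (b * s.[z] + c * (z * s^`().[z])) * s'.[z] + c * s.[z] * (z * s'^`().[z])
    - (c * (z * s^`().[z]) * s'.[z] + c * s.[z] * (z * s'^`().[z])) by ring.
by rewrite E; ring.
Qed.

Lemma jet1 : jet 1 1 0.
Proof.
by rewrite -tofrac1; have := jet_poly 1; rewrite derivC horner0 hornerC mulr0.
Qed.

Lemma jetN f a b : jet f a b -> jet (- f) (- a) (- b).
Proof.
move=> jf; have := jetM (jet_poly (- 1)) jf.
rewrite derivN derivC oppr0 horner0 mulr0 mul0r add0r hornerN hornerC !mulN1r.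
by rewrite tofracN tofrac1 mulN1r.
Qed.

Lemma jetB f g a b c d : jet f a b -> jet g c d -> jet (f - g) (a - c) (b - d).
Proof. by move=> jf jg; apply/jetD/jetN. Qed.

Lemma jet_sum n (f : nat -> K) (a b : nat -> C) :
  (forall i, (i < n)%N -> jet (f i) (a i) (b i)) ->
  jet (\sum_(i < n) f i) (\sum_(i < n) a i) (\sum_(i < n) b i).
Proof.
elim: n => [|n IHn] jf.
  rewrite !big_ord0 -tofrac0.
  by have := jet_poly 0; rewrite deriv0 horner0 mulr0.
rewrite !big_ord_recr /=; apply: jetD; last exact: jf.
by apply: IHn => i lt_in; apply/jf/ltnW.
Qed.


Lemma jet_sign k : jet ((-1) ^+ k) ((-1) ^+ k) 0.
Proof.
elim: k => [|k IHk]; first by rewrite !expr0; apply: jet1.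
by rewrite !exprS; have := jetM (jetN jet1) IHk; rewrite oppr0 mul0r mulr0 addr0.
Qed.

Lemma jet_prod1 n (f : nat -> K) (l : nat -> C) :
  (forall i, (i < n)%N -> jet (f i) 1 (l i)) ->
  jet (\prod_(i < n) f i) 1 (\sum_(i < n) l i).
Proof.
elim: n => [|n IHn] jf; first by rewrite !big_ord0; apply: jet1.
rewrite !big_ord_recr /=.
have /IHn jn : forall i, (i < n)%N -> jet (f i) 1 (l i).
  by move=> i lt_in; apply/jf/ltnW.
by have := jetM jn (jf n (ltnSn n)); rewrite !mulr1 mul1r.
Qed.

Lemma has_valueM f g a c :
  has_value f a -> has_value g c -> has_value (f * g) (a * c).
Proof. by move=> [b jf] [d jg]; exists (b * c + a * d); apply: jetM. Qed.

Lemma has_value_sum n (f : nat -> K) (a : nat -> C) :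
  (forall i, (i < n)%N -> has_value (f i) (a i)) ->
  has_value (\sum_(i < n) f i) (\sum_(i < n) a i).
Proof.
elim: n => [|n IHn] vf.
  by rewrite !big_ord0; exists (z * 0^`().[z]);
     rewrite -tofrac0 -[X in jet _ X _](horner0 z); apply: jet_poly.
rewrite !big_ord_recr /=.
have /IHn [b jn] : forall i, (i < n)%N -> has_value (f i) (a i).
  by move=> i lt_in; apply/vf/ltnW.
by have [d jf] := vf n (ltnSn n); exists (b + d); apply: jetD.
Qed.

Lemma has_value_prod (I : finType) (P : pred I) (f : I -> K) (a : I -> C) :
  (forall i, P i -> has_value (f i) (a i)) ->
  has_value (\prod_(i | P i) f i) (\prod_(i | P i) a i).
Proof.
move=> vf; apply: (big_ind2 has_value) => //; first by exists 0; apply: jet1.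
by move=> f1 a1 f2 a2; apply: has_valueM.
Qed.

Local Notation q := ('X%:F : K).

Lemma jet_qX k : jet (q ^+ k) (z ^+ k) (k%:R * z ^+ k).
Proof.
rewrite -tofracXn; have := jet_poly 'X^k.
rewrite derivXn hornerXn hornerMn hornerXn.
case: k => [|k] /=; first by rewrite mulr0n mul0r mulr0.
by rewrite mulrnAr -exprS mulr_natl.
Qed.

Hypothesis z_neq0 : z != 0.

(** This is where the exponents of the double sum become weights. *)
Lemma jet_qz (h : int) : jet (q ^ h) (z ^ h) (h%:~R * z ^ h).
Proof.
case: h => k; first exact: jet_qX.
rewrite NegzE -!exprnN.
have nzk : z ^+ k.+1 != 0 by rewrite expf_neq0.
have := jetV nzk (jet_qX k.+1).
by congr (jet _ _ _); rewrite mulrNz pmulrn; field.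
Qed.

Lemma jet_hecke_block r :
  jet (hecke_block (fun h => q ^ h) r)
    (hecke_block (fun h => z ^ h) r)
    (hecke_block (fun h => h%:~R * z ^ h) r).
Proof.
rewrite /hecke_block.
pose t (C' : pzRingType) (phi : int -> C') s := ((-1) ^+ (r + s) *
    (phi (hecke_exp r s) - phi (hecke_exp (- r.+1%:Z) s))) *+ (0 < s).+1.
apply: (@jet_sum _ (t K (fun h => q ^ h)) (t C (fun h => z ^ h))
         (t C (fun h => h%:~R * z ^ h))) => s _; rewrite /t {t}.
have j1 := jetM (jet_sign (r + s))
  (jetB (jet_qz (hecke_exp r s)) (jet_qz (hecke_exp (- r.+1%:Z) s))).
rewrite mul0r add0r in j1.
by case: (0 < s)%N; rewrite ?mulr1n // !mulr2n; apply: jetD.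
Qed.

Lemma fracX_neq0 : q != 0.
Proof. by rewrite tofrac_eq0 polyX_eq0. Qed.

Lemma fracX_generic k : q ^+ k.+1 != 1.
Proof.
rewrite -tofracXn -tofrac1 tofrac_eq; apply/eqP => Xk1.
by have := size_polyXn C k.+1; rewrite Xk1 size_poly1.
Qed.
End Jets.

(** * Specialisation at a primitive root of unity *)

Section RootOfUnity.
Variables (C : numFieldType) (N : nat) (z : C).
Local Notation n := N.+1.
Hypothesis prim_z : n.-primitive_root z.
Local Notation K := {fraction {poly C}}.
Local Notation q := (@FracField.tofrac {poly C} 'X).

Let z_neq0 : z != 0.
Proof.
apply/eqP => z0; have := prim_expr_order prim_z.
by rewrite z0 expr0n => /eqP; rewrite eq_sym oner_eq0.
Qed.

Let zn1 : z ^+ n = 1. Proof. exact: prim_expr_order. Qed.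

Let natC_neq0 k : k.+1%:R != 0 :> C. Proof. by rewrite pnatr_eq0. Qed.

Lemma root_expr_eq d e a b : (d + n * a = e + n * b)%N -> z ^+ d = z ^+ e.
Proof.
have zE m c : z ^+ (m + n * c) = z ^+ m by rewrite exprD exprM zn1 expr1n mulr1.
by rewrite -(zE d a) -(zE e b) => ->.
Qed.

Lemma subr_zX_neq0 i : (i < N)%N -> 1 - z ^+ i.+1 != 0.
Proof.
move=> lt_iN; rewrite subr_eq0 eq_sym -(prim_order_dvd prim_z).
by rewrite gtnNdvd.
Qed.

Lemma prod_nontrivial_roots :
  \prod_(i < N) ('X - (z ^+ i.+1)%:P) = \sum_(i < n) 'X^i.
Proof.
have nzX1 : 'X - 1 != 0 :> {poly C} by rewrite polyXsubC_eq0.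
apply: (mulfI nzX1); rewrite -subrX1.
by rewrite -(factor_Xn_sub_1 prim_z) big_mkord big_ord_recl expr0.
Qed.

Lemma qpoch_root : qpoch z z N = n%:R.
Proof.
have := congr1 (fun p => p.[1]) prod_nontrivial_roots.
rewrite /= horner_prod horner_sum.
under [RHS]eq_bigr => i _ do rewrite hornerXn expr1n.
rewrite sumr_const card_ord => <-.
by apply: eq_bigr => i _; rewrite hornerXsubC -exprS.
Qed.

Lemma qpoch_neg_root_odd : odd n -> qpoch (- z) z N = 1.
Proof.
move=> odd_n; have := congr1 (fun p => p.[-1]) prod_nontrivial_roots.
rewrite /= horner_prod horner_sum.
under [RHS]eq_bigr => i _ do rewrite hornerXn.
under eq_bigr => i _ do rewrite hornerXsubC -opprD.
rewrite prodrN card_ord -signr_odd; move: (odd_n) => /= /negPf->.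
rewrite mul1r => prodE.
have -> : qpoch (- z) z N = \prod_(i < N) (1 + z ^+ i.+1).
  by apply: eq_bigr => i _; rewrite mulNr opprK -exprS.
rewrite prodE; apply: (@mulfI _ (-1 - 1)).
  by rewrite -opprD oppr_eq0 (natC_neq0 1).
by rewrite -subrX1 -signr_odd odd_n expr1 mulr1.
Qed.

Lemma root_half h : n = h.+1.*2 -> z ^+ h.+1 = -1.
Proof.
move=> nE; have /eqP : (z ^+ h.+1) ^+ 2 = 1 by rewrite -exprM muln2 -nE.
rewrite sqrf_eq1 -(prim_order_dvd prim_z) gtnNdvd //=; last by lia.
by move/eqP.
Qed.

(** The product of 1 + z^i over the nontrivial roots, without its zero factor
    i = n/2: dividing 1 + X + ... + X^(n-1) by X + 1 leaves
    1 + X^2 + ... + X^(n-2), which is n/2 at X = -1. *)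
Lemma prod_neg_root_even h : n = h.+1.*2 ->
  \prod_(i < N | val i != h) (1 + z ^+ i.+1) = h.+1%:R.
Proof.
move=> nE.
have zh := root_half nE.
have lt_hN : (h < N)%N by lia.
have nzX1 : 'X + 1 != 0 :> {poly C}.
  by rewrite -[1]opprK -[- 1]polyCN polyXsubC_eq0.
have prodE : \prod_(i < N | val i != h) ('X - (z ^+ i.+1)%:P)
          = \sum_(i < h.+1) ('X^2) ^+ i.
  apply: (mulfI nzX1).
  have := prod_nontrivial_roots; rewrite (bigD1 (Ordinal lt_hN)) //= zh.
  rewrite polyCN opprK => ->.
  have nzX2 : 'X - 1 != 0 :> {poly C} by rewrite polyXsubC_eq0.
  apply: (mulfI nzX2); rewrite mulrA -subrX1.
  have -> : ('X - 1) * ('X + 1) = 'X^2 - 1 :> {poly C} by ring.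
  by rewrite -subrX1 -exprM mul2n nE.
have := congr1 (fun p => p.[-1]) prodE.
rewrite /= horner_prod horner_sum.
under [RHS]eq_bigr => i _ do rewrite horner_exp hornerXn sqrrN expr1n expr1n.
rewrite sumr_const card_ord.
under eq_bigr => i _ do rewrite hornerXsubC -opprD.
rewrite prodrN -signr_odd (_ : odd _ = false) ?mul1r //.
rewrite (eq_card (B := predC1 (Ordinal lt_hN))) //.
by rewrite cardC1 card_ord; lia.
Qed.

(** At q = z the numerator is 1 - z^(i+1), like the denominator. *)
Lemma jet_factor i : (i < N)%N ->
  jet z ((q ^+ n - q ^+ i.+1) / (1 - q ^+ (n + i.+1))) 1
    (n%:R * (1 + z ^+ i.+1) / (1 - z ^+ i.+1)).
Proof.
move=> lt_iN; have nz := subr_zX_neq0 lt_iN.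
have zE : z ^+ (n + i.+1) = z ^+ i.+1 by rewrite exprD zn1 mul1r.
have j1 := jetB (jet_qX z n) (jet_qX z i.+1).
have j2 := jetB (jet1 z) (jet_qX z (n + i.+1)).
rewrite zE in j2; rewrite zn1 in j1.
have := jetM j1 (jetV nz j2).
by congr (jet _ _ _ _); [rewrite divff | rewrite natrD; field].
Qed.

Lemma jet_sum_hecke :
  jet z (\sum_(r < n) hecke_block (fun h => q ^ h) r
     * \prod_(i < r) ((q ^+ n - q ^+ i.+1) / (1 - q ^+ (n + i.+1))))
   (\sum_(r < n) hecke_block (fun h => z ^ h) r)
   (\sum_(r < n) (hecke_block (fun h => h%:~R * z ^ h) r
     + hecke_block (fun h => z ^ h) r
       * \sum_(i < r) (n%:R * (1 + z ^+ i.+1) / (1 - z ^+ i.+1)))).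
Proof.
apply: (@jet_sum _ z n
  (fun r => hecke_block (fun h => q ^ h) r
     * \prod_(i < r) ((q ^+ n - q ^+ i.+1) / (1 - q ^+ (n + i.+1))))
  (hecke_block (fun h => z ^ h))
  (fun r => hecke_block (fun h => h%:~R * z ^ h) r
     + hecke_block (fun h => z ^ h) r
       * \sum_(i < r) (n%:R * (1 + z ^+ i.+1) / (1 - z ^+ i.+1)))) => r lt_rn.
have jp : jet z
    (\prod_(i < r) ((q ^+ n - q ^+ i.+1) / (1 - q ^+ (n + i.+1)))) 1
    (\sum_(i < r) (n%:R * (1 + z ^+ i.+1) / (1 - z ^+ i.+1))).
  apply: (@jet_prod1 _ z r
    (fun i => (q ^+ n - q ^+ i.+1) / (1 - q ^+ (n + i.+1)))
    (fun i => n%:R * (1 + z ^+ i.+1) / (1 - z ^+ i.+1))) => i lt_ir.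
  exact/jet_factor/(leq_trans lt_ir).
by have := jetM (jet_hecke_block z_neq0 r) jp; rewrite !mulr1.
Qed.

Lemma has_value_sum_qpoch :
  has_value z (\sum_(m < n) \prod_(i < m) (q ^+ i.+1 - q ^+ n))
    (\sum_(m < n) qpoch z z m * (-1) ^+ m).
Proof.
apply: (@has_value_sum _ z n (fun m => \prod_(i < m) (q ^+ i.+1 - q ^+ n))
  (fun m => qpoch z z m * (-1) ^+ m)) => m _.
have -> : qpoch z z m * (-1) ^+ m = \prod_(i < m) (z ^+ i.+1 - z ^+ n).
  rewrite -[m in (-1) ^+ m]card_ord mulrC -prodrN.
  by apply: eq_bigr => i _; rewrite zn1 -exprS opprB.
by apply: has_value_prod => i _; eexists; apply: jetB; apply: jet_qX.
Qed.

Lemma has_value_qpoch : has_value z (qpoch q q N) n%:R.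
Proof.
rewrite -qpoch_root; apply: has_value_prod => i _.
by rewrite -!exprS; eexists; apply: jetB; [apply: jet1 | apply: jet_qX].
Qed.

Lemma has_value_1Dq i : has_value z (1 + q ^+ i) (1 + z ^+ i).
Proof. by eexists; apply: jetD; [apply: jet1 | apply: jet_qX]. Qed.

Let identity_K := hecke_identity_product
  (fracX_neq0 C) (@fracX_generic C) N.

(** If n is odd and [g] changes sign under s -> n-s, then the terms of index
    s and n-s cancel in the difference of the two partial sums. *)
Lemma sum_reflect (g : nat -> C) k : N = k.*2 ->
  (forall s, (0 < s)%N -> (s < n)%N -> g (n - s)%N = - g s) ->
  forall r, (r < n)%N -> \sum_(s < (N - r).+1) g s = \sum_(s < r.+1) g s.
Proof.
move=> NE g_anti.
(* Start from the middle, where both sums have k+1 terms. *)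
have main t : (t <= k)%N ->
    \sum_(s < (k + t).+1) g s = \sum_(s < (k - t).+1) g s.
  elim: t => [|t IHt] lt_tk; first by rewrite addn0 subn0.
  have [m kE] : exists m, k = (m + t.+1)%N by exists (k - t.+1)%N; rewrite subnK.
  rewrite addnS big_ord_recr /= IHt 1?ltnW //.
  have -> : (k - t = m.+1)%N by lia.
  have -> : (k - t.+1 = m)%N by lia.
  have -> : (k + t).+1 = (n - m.+1)%N by lia.
  by rewrite big_ord_recr /= g_anti ?addrK //; lia.
move=> r lt_rn; case: (leqP r k) => le_rk.
  have -> : (N - r = k + (k - r))%N by lia.
  by rewrite main ?leq_subr // subKn.
have -> : (N - r = k - (r - k))%N by lia.
have le_rkk : (r - k <= k)%N by lia.
by rewrite -(main _ le_rkk) subnKC // ltnW.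
Qed.

(** Modulo n, r -> n-1-r is r -> -1-r, which exchanges the two exponents
    r(3r+1)/2 and r(3r+1)/2 + 2r+1 of the block. The partial theta sum is
    unchanged by [sum_reflect], as its terms of index s and n-s are opposite
    when n is odd. *)
Lemma hecke_block_reflect (odd_n : odd n) r : (r < n)%N ->
  hecke_block (fun h => z ^ h) (N - r) = - hecke_block (fun h => z ^ h) r.
Proof.
move=> lt_rn.
have NE : N = N./2.*2 by have := odd_double_half N; move: odd_n => /=; lia.
have signE : (-1) ^+ (N - r) = (-1) ^+ r :> C.
  by rewrite -[LHS]signr_odd -[RHS]signr_odd oddB // {1}NE odd_double.
have thetaE : partial_theta z (N - r) = partial_theta z r.
  apply: (sum_reflect NE) => // s s_gt0 lt_sn.
  rewrite /theta_term subn_gt0 lt_sn s_gt0.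
  have -> : z ^+ ((n - s) * (n - s)) = z ^+ (s * s).
    have E : ((n - s) * (n - s) + n * (2 * s) = s * s + n * n)%N.
      have [t ->] : exists t, n = (t + s)%N by exists (n - s)%N; rewrite subnK 1?ltnW.
      by rewrite addnK; lia.
    exact: root_expr_eq E.
  have -> : (-1) ^+ (n - s) = - (-1) ^+ s :> C.
    rewrite -[LHS]signr_odd -[in RHS]signr_odd oddB 1?ltnW // odd_n.
    by case: (odd s) => /=; rewrite ?expr0 ?expr1 ?opprK.
  by rewrite mulNr mulNrn.
have expE : z ^+ ('C((N - r).+1, 2) + (N - r) * (N - r))
            = z ^+ ('C(r.+1, 2) + r * r) * z ^+ (2 * r).+1.
  have E : ('C((N - r).+1, 2) + (N - r) * (N - r) + n * (3 * r.+1)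
            = 'C(r.+1, 2) + r * r + (2 * r).+1 + n * (3 * N./2 + 2))%N.
    have := mulS_bin2 (N - r); have := mulS_bin2 r.
    have [t Nt] : exists t, N = (t + r)%N by exists (N - r)%N; rewrite subnK.
    have -> : (N - r = t)%N by lia.
    by move: NE; rewrite Nt; move: (t + r)./2 => k; nia.
  by rewrite -exprD; apply: root_expr_eq E.
rewrite !hecke_block_theta // signE thetaE expE.
have zE : z ^+ (2 * r).+1 * z ^+ (2 * (N - r)).+1 = 1.
  rewrite -exprD.
  have -> : ((2 * r).+1 + (2 * (N - r)).+1 = n * 2)%N by lia.
  by rewrite exprM zn1 expr1n.
set X := z ^+ (2 * r).+1 in zE *; set Y := z ^+ (2 * (N - r)).+1 in zE *.
set P := z ^+ _; rewrite mulrBr mulr1.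
by rewrite -[_ * Y]mulrA -[P * X * Y]mulrA zE; ring.
Qed.

(** (1 + z^s) / (1 - z^s) changes sign under z^s -> z^(-s). *)
Lemma log_derivative_reflect (odd_n : odd n) r : (r < n)%N ->
  \sum_(i < N - r) (n%:R * (1 + z ^+ i.+1) / (1 - z ^+ i.+1))
  = \sum_(i < r) (n%:R * (1 + z ^+ i.+1) / (1 - z ^+ i.+1)).
Proof.
move=> lt_rn.
have NE : N = N./2.*2 by have := odd_double_half N; move: odd_n => /=; lia.
(* The term at 0 vanishes because 1 - z ^+ 0 has inverse 0. *)
pose g s := n%:R * (1 + z ^+ s) / (1 - z ^+ s).
have g0 : g 0%N = 0 by rewrite /g expr0 subrr invr0 mulr0.
have gE m : \sum_(i < m) g i.+1 = \sum_(i < m.+1) g i.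
  by rewrite big_ord_recl g0 add0r.
rewrite (gE (N - r)%N) (gE r); apply: (sum_reflect NE) => // s s_gt0 lt_sn.
have nz : 1 - z ^+ s != 0 by have := @subr_zX_neq0 s.-1; rewrite prednK //; apply.
have zE : z ^+ s * z ^+ (n - s) = 1 by rewrite -exprD subnKC 1?ltnW.
rewrite /g; set X := z ^+ s in nz zE *; set Y := z ^+ (n - s) in zE *.
have X0 : X != 0 by rewrite expf_neq0.
have YE : Y = X^-1 by rewrite -[RHS]mulr1 -zE mulKf.
by rewrite YE; field; rewrite nz X0 -oppr_eq0 opprB nz.
Qed.

(** Both sides of [hecke_identity_product] vanish at z; this is the equality
    of their Euler derivatives, where 1 - q^n contributes -n and (q)_N
    contributes its value n. *)
Lemma double_sum_odd : odd n ->
  \sum_(r < n) hecke_block (fun h => h%:~R * z ^ h) r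
  = - (n%:R ^+ 2 * \sum_(m < n) qpoch z z m * (-1) ^+ m).
Proof.
move=> odd_n.
pose c r := hecke_block (fun h => z ^ h) r.
pose l r := \sum_(i < r) (n%:R * (1 + z ^+ i.+1) / (1 - z ^+ i.+1)).
have antisym (f : nat -> C) : (forall r, (r < n)%N -> f (N - r)%N = - f r) ->
    \sum_(r < n) f r = 0.
  move=> f_anti; have E : \sum_(r < n) f r = - \sum_(r < n) f r.
    rewrite {1}(reindex_inj rev_ord_inj) /= -sumrN.
    by apply: eq_bigr => r _; rewrite subSS f_anti.
  apply/eqP; move/eqP: E; rewrite -addr_eq0 -mulr2n -mulr_natl mulf_eq0.
  by rewrite (negPf (natC_neq0 1)).
have c_sum0 : \sum_(r < n) c r = 0.
  by apply: antisym => r; apply: hecke_block_reflect.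
have cl_sum0 : \sum_(r < n) c r * l r = 0.
  apply: (antisym (fun r => c r * l r)) => r lt_rn.
  by rewrite /l /c hecke_block_reflect // log_derivative_reflect // mulNr.
have [b jden] : has_value z (qpoch (- q) q N) 1.
  rewrite -qpoch_neg_root_odd //; apply: has_value_prod => i _.
  by rewrite !mulNr !opprK -!exprS; apply: has_value_1Dq.
have [b1 jq] := has_value_qpoch.
have [b2 jL] := has_value_sum_qpoch.
have j1 := jetM jden jet_sum_hecke.
have j2 := jetM (jetM jq (jetB (jet1 z) (jet_qX z n))) jL.
rewrite identity_K in j1.
have [_] := jet_unique j1 j2.
rewrite zn1 c_sum0 big_split /= cl_sum0 addr0 mulr0 add0r mul1r => ->.
by ring.
Qed.

(** [hecke_identity_product] divided by 1 + q^(n/2), at q = z: the left side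
    becomes n/2 times the double sum, the right side n * 2 times the sum of
    the (z)_m (-1)^m. *)
Lemma double_sum_even : ~~ odd n ->
  \sum_(r < n) hecke_block (fun h => z ^ h) r
  = 4%:R * \sum_(m < n) qpoch z z m * (-1) ^+ m.
Proof.
move=> even_n.
have [h nE] : exists h, n = h.+1.*2.
  have := odd_double_half n; rewrite (negPf even_n) add0n.
  by case: (n./2) => // h <-; exists h.
have lt_hN : (h < N)%N by lia.
have zh := root_half nE.
have qh : 1 + q ^+ h.+1 != 0 :> K.
  have := qpoch_Nq_neq0 (@fracX_generic C) h.+1.
  by rewrite qpochS mulNr opprK -exprS mulf_eq0 negb_or => /andP[].
have [b jW] : has_value z (\prod_(i < N | val i != h) (1 + q ^+ i.+1)) h.+1%:R.
  rewrite -(prod_neg_root_even nE); apply: has_value_prod => i _.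
  exact: has_value_1Dq.
have NqE : qpoch (- q) q N
  = (1 + q ^+ h.+1) * \prod_(i < N | val i != h) (1 + q ^+ i.+1).
  transitivity (\prod_(i < N) (1 + q ^+ i.+1) : K).
    by apply: eq_bigr => i _; rewrite mulNr opprK -exprS.
  by rewrite (bigD1 (Ordinal lt_hN)).
have qnE : 1 - q ^+ n = (1 + q ^+ h.+1) * (1 - q ^+ h.+1).
  by rewrite nE -addnn exprD; ring.
have reduced := identity_K; rewrite NqE qnE in reduced.
rewrite -[LHS]mulrA [in RHS]mulrCA -[RHS]mulrA in reduced.
have {}reduced := mulfI qh reduced.
have [b1 jq] := has_value_qpoch.
have [b2 jL] := has_value_sum_qpoch.
have j1 := jetM jW jet_sum_hecke.
have j2 := jetM (jetM jq (jetB (jet1 z) (jet_qX z h.+1))) jL.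
rewrite reduced in j1.
have [E _] := jet_unique j1 j2.
apply: (mulfI (natC_neq0 h)); rewrite E zh nE opprK -muln2 natrM.
by ring.
Qed.
End RootOfUnity.

(** * From q to 1/q *)

Section Inversion.
Variables (F : fieldType) (N : nat) (q : F).
Local Notation n := N.+1.
Hypothesis prim_q : n.-primitive_root q.

Let qn1 : q ^+ n = 1. Proof. exact: prim_expr_order. Qed.

Let q_neq0 : q != 0.
Proof.
by apply/eqP => q0; have /eqP := qn1; rewrite q0 expr0n eq_sym oner_eq0.
Qed.

Lemma primitive_rootV : n.-primitive_root q^-1.
Proof.
have -> : q^-1 = q ^+ N by rewrite -[RHS]mul1r -(mulVf q_neq0) -mulrA -exprS qn1 mulr1.
have := exp_prim_root prim_q N.
by have /eqP-> := coprimenS N; rewrite divn1.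
Qed.

(** With u_k = (q)_k (x)_k, the terms of index k add up to u_k - u_(k+1), and
    u_n = 0. *)
Lemma sum_qpoch_functional x :
  (\sum_(k < n) qpoch q q k * qpoch (x * q) q k * q ^+ k.+1) * (1 - x)
  + x / q * (\sum_(k < n) qpoch q q k * qpoch (x / q * q) q k * q ^+ k.+1) = 1.
Proof.
have tele m : (\sum_(k < m) qpoch q q k * qpoch (x * q) q k * q ^+ k.+1) * (1 - x)
    + x / q * (\sum_(k < m) qpoch q q k * qpoch (x / q * q) q k * q ^+ k.+1)
    = 1 - qpoch q q m * qpoch x q m.
  elim: m => [|m IHm].
    by rewrite !big_ord0 !qpoch0 mul0r mulr0 addr0 mulr1 subrr.
  rewrite !big_ord_recr /= mulrDl [x / q * _]mulrDr addrACA IHm divfK //.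
  have E : (1 - x) * qpoch (x * q) q m = qpoch x q m * (1 - x * q ^+ m).
    by rewrite -qpochSl qpochS.
  rewrite qpoch_qS qpochS exprS.
  transitivity (1 - qpoch q q m * qpoch x q m
    + (qpoch q q m * ((1 - x) * qpoch (x * q) q m) * (q * q ^+ m)
       + x / q * (qpoch q q m * qpoch x q m * (q * q ^+ m)))); first by ring.
  by rewrite E; field.
by rewrite tele qpoch_qS qn1 subrr mulr0 mul0r subr0.
Qed.

(** With u_k = (1/q;1/q)_k x^k, the terms of index k add up to
    u_k - u_(k+1), and u_n = 0. *)
Lemma sum_qpoch_inv_functional x :
  (\sum_(k < n) qpoch q^-1 q^-1 k * x ^+ k) * (1 - x)
  + x / q * (\sum_(k < n) qpoch q^-1 q^-1 k * (x / q) ^+ k) = 1.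
Proof.
have tele m : (\sum_(k < m) qpoch q^-1 q^-1 k * x ^+ k) * (1 - x)
    + x / q * (\sum_(k < m) qpoch q^-1 q^-1 k * (x / q) ^+ k)
    = 1 - qpoch q^-1 q^-1 m * x ^+ m.
  elim: m => [|m IHm].
    by rewrite !big_ord0 !qpoch0 mul0r mulr0 addr0 mulr1 subrr.
  rewrite !big_ord_recr /= mulrDl [x / q * _]mulrDr addrACA IHm.
  by rewrite qpoch_qS !exprS exprMn; ring.
by rewrite tele qpoch_qS exprVn qn1 invr1 subrr mulr0 mul0r subr0.
Qed.

(** The difference d of two solutions satisfies the homogeneous equation.
    Iterating it n times leads from x back to x, and gives
    (1 - x^n) d(x) = - x^n d(x), that is d(x) = 0. *)
Lemma functional_equation_unique (f g : F -> F) :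
  (forall x, f x * (1 - x) + x / q * f (x / q) = 1) ->
  (forall x, g x * (1 - x) + x / q * g (x / q) = 1) ->
  forall x, x != 0 -> f x = g x.
Proof.
move=> fE gE x x_neq0; pose d y := f y - g y.
have dE y : d y * (1 - y) = - (y / q) * d (y / q).
  have E : f y * (1 - y) + y / q * f (y / q) = g y * (1 - y) + y / q * g (y / q).
    by rewrite fE gE.
  rewrite /d.
  have -> : (f y - g y) * (1 - y) = (f y * (1 - y) + y / q * f (y / q))
      - g y * (1 - y) - y / q * f (y / q) by ring.
  by rewrite E; ring.
have iter m : d x * \prod_(i < m) (1 - x * q^-1 ^+ i)
    = \prod_(i < m) (- (x * q^-1 ^+ i.+1)) * d (x * q^-1 ^+ m).
  elim: m => [|m IHm]; first by rewrite !big_ord0 mulr1 mul1r expr0 mulr1.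
  rewrite !big_ord_recr /= mulrA IHm -[LHS]mulrA dE -[RHS]mulrA.
  by rewrite -(mulrA x) -exprSr.
have := iter n; rewrite exprVn qn1 invr1 mulr1.
have rootsE y : \prod_(i < n) (y - q^-1 ^+ i) = y ^+ n - 1.
  have := congr1 (fun p => p.[y]) (factor_Xn_sub_1 primitive_rootV).
  rewrite /= big_mkord horner_prod !(hornerE, hornerXn) => <-.
  by apply: eq_bigr => i _; rewrite hornerXsubC.
have -> : \prod_(i < n) (1 - x * q^-1 ^+ i) = 1 - x ^+ n.
  transitivity (\prod_(i < n) (x * (x^-1 - q^-1 ^+ i))).
    by apply: eq_bigr => i _; rewrite mulrBr divff.
  rewrite big_split /= prodr_const card_ord rootsE mulrBr mulr1 -exprMn.
  by rewrite divff // expr1n.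
have -> : \prod_(i < n) (- (x * q^-1 ^+ i.+1)) = - x ^+ n.
  transitivity (\prod_(i < n) (x / q * (0 - q^-1 ^+ i))).
    by apply: eq_bigr => i _; rewrite exprS; ring.
  rewrite big_split /= prodr_const card_ord rootsE expr0n sub0r mulrN1.
  by rewrite exprMn exprVn qn1 invr1 mulr1.
rewrite mulrBr mulr1 mulNr (mulrC (d x)) => /(canRL (subrK _)).
by rewrite addNr => /eqP; rewrite subr_eq0 => /eqP.
Qed.

(** The case x = -1, since (q)_k (-q)_k = (q^2;q^2)_k. Up
    to normalisation this is Cohen's duality between the functions sigma and
    sigma* of Andrews, Dyson and Hickerson at roots of unity. *)
Lemma sum_qpoch_inversion :
  \sum_(k < n) qpoch (q ^+ 2) (q ^+ 2) k * q ^+ k.+1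
  = \sum_(k < n) qpoch q^-1 q^-1 k * (-1) ^+ k.
Proof.
have N1_neq0 : -1 != 0 :> F by rewrite oppr_eq0 oner_eq0.
rewrite -(functional_equation_unique sum_qpoch_functional
            sum_qpoch_inv_functional N1_neq0).
apply: eq_bigr => k _; congr (_ * _).
rewrite /qpoch -big_split /=; apply: eq_bigr => i _.
by rewrite -exprM mulnC exprM; ring.
Qed.
End Inversion.

(** * Unfolding the reversed sums *)

Section Isum.
Variable V : zmodType.
Implicit Type f : int -> V.

Lemma isum_split (m k : nat) f :
  isum (- m%:Z) k%:Z f = \sum_(i < m) f (- i.+1%:Z) + \sum_(i < k.+1) f i%:Z.
Proof.
rewrite /isum; have -> : - m%:Z <= k%:Z by lia.
have -> : (absz (k%:Z - - m%:Z)%R).+1 = (m + k.+1)%N by lia.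
rewrite big_split_ord /=; congr (_ + _).
  rewrite (reindex_inj rev_ord_inj) /=; apply: eq_bigr => i _.
  by congr (f _); have := ltn_ord i; lia.
by apply: eq_bigr => i _; congr (f _); lia.
Qed.

Lemma isum_even (r : nat) f : (forall j, f (- j) = f j) ->
  isum (- r%:Z) r%:Z f = \sum_(s < r.+1) f s%:Z *+ (0 < s).+1.
Proof.
move=> f_even; rewrite isum_split addrC !big_ord_recl /= mulr1n -addrA.
congr (_ + _); rewrite -big_split /=; apply: eq_bigr => i _.
by rewrite f_even /bump /= add1n mulr2n.
Qed.
End Isum.

(** For k = -r-1 the inner sum is reversed, and is minus the sum over
    |j| <= r. This sign is cancelled by sgn(k) = -1, so that the parity of
    k + j alone opposes the two terms of a block. *)
Lemma isum_hecke_block (F : fieldType) (phi : int -> F) (N : nat) :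
  isum (- N.+1%:Z) (N.+1%:Z - 1) (fun k : int => isum (- k) k (fun j : int =>
     (sgn k)%:~R * (-1) ^ (k + j) * phi (hecke_exp k j)))
  = \sum_(r < N.+1) hecke_block phi r.
Proof.
have sgnz (h : int) : (-1) ^ (- h) = (-1) ^ h :> F.
  by case: h => k; rewrite ?NegzE ?opprK -exprnN invr_sign.
have even k j : (sgn k)%:~R * (-1) ^ (k + - j) * phi (hecke_exp k (- j))
  = (sgn k)%:~R * (-1) ^ (k + j) * phi (hecke_exp k j).
  by rewrite /hecke_exp sqrrN !expfzDr ?oppr_eq0 ?oner_eq0 // sgnz.
have -> : N.+1%:Z - 1 = N%:Z by lia.
rewrite isum_split -big_split /=; apply: eq_bigr => r _.
rewrite isum_rev; last by lia.
have -> : - r.+1%:Z + 1 = - r%:Z by lia.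
have -> : - - r.+1%:Z - 1 = r%:Z by lia.
rewrite !isum_even // addrC -sumrB; apply: eq_bigr => s _.
rewrite -mulrnBl; congr (_ *+ _).
rewrite /sgn /= mulr1z mul1r -PoszD -exprnP.
rewrite expfzDr ?oppr_eq0 ?oner_eq0 // sgnz -!exprnP exprS exprD.
by rewrite mulrN1z; ring.
Qed.

Lemma eq_isum (V : zmodType) a b (f g : int -> V) :
  f =1 g -> isum a b f = isum a b g.
Proof.
by move=> fg; rewrite /isum; case: ifP => _; [|congr (- _)]; apply: eq_bigr.
Qed.

(** * The evaluations *)

Section DoubleSums.
Variables (C : numFieldType) (N : nat) (z : C).
Local Notation n := N.+1.
Hypothesis prim_z : n.-primitive_root z.

Lemma sum_qpoch_odd : odd n ->
  \sum_(k < n) qpoch z z k * (-1) ^+ k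
  = -1 / n%:R ^+ 2 *
    isum (- n%:Z) (n%:Z - 1) (fun k : int => isum (- k) k (fun j : int =>
      (sgn k)%:~R * (hecke_exp k j)%:~R * (-1) ^ (k + j) * z ^ hecke_exp k j)).
Proof.
move=> odd_n.
rewrite [isum _ _ _](_ : _
    = \sum_(r < n) hecke_block (fun h => h%:~R * z ^ h) r); last first.
  rewrite -isum_hecke_block; do 2![apply: eq_isum => ?].
  by rewrite [RHS]mulrA; congr (_ * _); rewrite mulrAC.
rewrite double_sum_odd //.
by rewrite mulN1r mulNr mulrN opprK mulKf // expf_neq0 // pnatr_eq0.
Qed.

Lemma sum_qpoch_even : ~~ odd n ->
  \sum_(k < n) qpoch z z k * (-1) ^+ k
  = 1 / 4 *
    isum (- n%:Z) (n%:Z - 1) (fun k : int => isum (- k) k (fun j : int =>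
      (sgn k)%:~R * (-1) ^ (k + j) * z ^ hecke_exp k j)).
Proof.
move=> even_n; rewrite isum_hecke_block double_sum_even //.
by field.
Qed.
End DoubleSums.

Theorem proposition3p3 (R : realType) (n : nat) (q : R[i]) :
  (1 <= n)%N -> n.-primitive_root q ->
  ((odd n ->
      \sum_(k < n) qpoch q q k * (-1) ^+ k
      = -1 / n%:R ^+ 2 *
        isum (- n%:Z) (n%:Z - 1) (fun k : int =>
          isum (- k) k (fun j : int =>
            (sgn k)%:~R * (hecke_exp k j)%:~R * (-1) ^ (k + j)
              * q ^ hecke_exp k j)))
   /\
   (~~ odd n ->
      \sum_(k < n) qpoch q q k * (-1) ^+ k
      = 1 / 4 *
        isum (- n%:Z) (n%:Z - 1) (fun k : int =>
          isum (- k) k (fun j : int =>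
            (sgn k)%:~R * (-1) ^ (k + j) * q ^ hecke_exp k j))))
  /\
  ((odd n ->
      \sum_(k < n) qpoch (q ^+ 2) (q ^+ 2) k * q ^+ k.+1
      = -1 / n%:R ^+ 2 *
        isum (- n%:Z) (n%:Z - 1) (fun k : int =>
          isum (- k) k (fun j : int =>
            (sgn k)%:~R * (hecke_exp k j)%:~R * (-1) ^ (k + j)
              * q ^ (- hecke_exp k j))))
   /\
   (~~ odd n ->
      \sum_(k < n) qpoch (q ^+ 2) (q ^+ 2) k * q ^+ k.+1
      = 1 / 4 *
        isum (- n%:Z) (n%:Z - 1) (fun k : int =>
          isum (- k) k (fun j : int =>
            (sgn k)%:~R * (-1) ^ (k + j) * q ^ (- hecke_exp k j))))).
Proof.
case: n => // N _ prim_q.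
have prim_qV := primitive_rootV prim_q.
have inv_expz (h : int) : q ^ (- h) = q^-1 ^ h by rewrite exprz_inv.
split; split=> parity_n.
- exact: sum_qpoch_odd.
- exact: sum_qpoch_even.
- rewrite sum_qpoch_inversion // sum_qpoch_odd //; congr (_ * _).
  by do 2![apply: eq_isum => ?]; rewrite inv_expz.
- rewrite sum_qpoch_inversion // sum_qpoch_even //; congr (_ * _).
  by do 2![apply: eq_isum => ?]; rewrite inv_expz.
Qed.
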